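(* Let $A$ be a left brace and let $(X,r)$ be a set-theoretic solution of the quantum Yang-Baxter equation such that $X\subseteq A$ and $r$ is a restriction of the Yang-Baxter map associated to $A$. Let $I$ be an ideal in $A$, and denote $[x]_I=\{x+i : i\in I\}$ for $x\in X$. Define the relation $\sim$ on the sets $[x]_I$ by: $[x]_I\sim[y]_I$ if and only if $x-y\in I$. Then $\sim$ is an equivalence relation. Let $X_I$ be the set of equivalence classes of this relation. Denote $r(x,y)=({}^xy,x^y)$ for $x,y\in X$ and define $\tilde r([x]_I,[y]_I)=([{}^xy]_I,[x^y]_I)$. Then $(X_I,\tilde r)$ is a non-degenerate involutive set-theoretic solution of the quantum Yang-Baxter equation.
   Context: A set-theoretic solution of the quantum Yang-Baxter equation is a pair $(X,r)$ with $X$ a non-empty set and $r:X\times X\to X\times X$ a bijection, written $r(x,y)=({}^xy,x^y)=(\sigma_x(y),\tau_y(x))$, satisfying $r_1r_2r_1=r_2r_1r_2$ on $X^3$, where $r_1=r\times \mathrm{id}_X$, $r_2=\mathrm{id}_X\times r$. It is non-degenerate if all $\sigma_x,\tau_x$ are permutations of $X$, and involutive if $r^2=\mathrm{id}$. A left brace is an abelian group $(A,+)$ with a multiplication $\cdot$ such that $a\cdot(b+c)=a\cdot b+a\cdot c$ and the operation $a\circ b=a\cdot b+a+b$ makes $A$ a group. The Yang-Baxter map associated to $A$ is $r':A\times A\to A\times A$, $r'(x,y)=(x\cdot y+y,\ z\cdot x+x)$, where $z$ is the unique element with $z\cdot(x\cdot y+y)+z+x\cdot y+y=0$. A map $r:X\times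 X\to X\times X$ with $X\subseteq A$ is a restriction of $r'$ if $r(x,y)=r'(x,y)$ for all $x,y\in X$. An ideal of $A$ is an additive subgroup $I$ of $A$ such that $z\cdot x,\ x\cdot z\in I$ for all $x\in I$, $z\in A$.
   Formalization: Non-degeneracy of the quotient solution is claimed only when (X,r) is itself non-degenerate; without this it can fail for infinite X, e.g. A={2m/(2n+1)}, X=A∩(−1,0), I=0. All other claims are proved without this assumption. *)

(* Defs.v *)
From mathcomp Require Import all_boot all_order all_algebra.
From mathcomp Require Import boolp classical_sets functions.
From Corelib Require Import RelationClasses.

Set Implicit Arguments.
Unset Strict Implicit.
Unset Printing Implicit Defensive.

Import GRing.Theory.
Local Open Scope classical_set_scope.
Local Open Scope ring_scope.

(* [lact r x y] is ^x y = sigma_x(y) and [ract r x y] is x^y = tau_y(x). *)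
Definition lact (T : Type) (r : T * T -> T * T) (x y : T) : T := (r (x, y)).1.
Definition ract (T : Type) (r : T * T -> T * T) (x y : T) : T := (r (x, y)).2.

Definition ybe_r1 (T : Type) (r : T * T -> T * T) (p : T * T * T) : T * T * T :=
  (r p.1, p.2).
Definition ybe_r2 (T : Type) (r : T * T -> T * T) (p : T * T * T) : T * T * T :=
  let: (x, y, z) := p in (x, lact r y z, ract r y z).

Record ybe_solution (T : Type) (r : T * T -> T * T) : Prop := YbeSolution {
  ybe_inhabited : inhabited T;
  ybe_bijective : bijective r;
  ybe_braid : forall p : T * T * T,
    ybe_r1 r (ybe_r2 r (ybe_r1 r p)) = ybe_r2 r (ybe_r1 r (ybe_r2 r p)) }.

Definition ybe_nondegenerate (T : Type) (r : T * T -> T * T) : Prop :=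
  (forall x, bijective (lact r x)) /\ (forall y, bijective (ract r ^~ y)).

Definition is_group_law (T : Type) (op : T -> T -> T) : Prop :=
  associative op /\
  exists e : T, [/\ left_id e op, right_id e op &
    forall a, exists b, op a b = e /\ op b a = e].

Definition brace_circ (A : zmodType) (mul : A -> A -> A) (a b : A) : A :=
  mul a b + a + b.

Record is_left_brace (A : zmodType) (mul : A -> A -> A) : Prop := IsLeftBrace {
  left_brace_distr : forall a b c, mul a (b + c) = mul a b + mul a c;
  left_brace_group : is_group_law (brace_circ mul) }.

(* In a left brace exactly one z satisfies the equation below, namely the
   inverse of x . y + y for the circle operation, so the default value 0 of
   [xget] is never used. *)
Definition yb_map (A : zmodType) (mul : A -> A -> A) (p : A * A) : A * A :=
  let: (x, y) := p in
  let u := mul x y + y in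
  let z := xget 0 [set z : A | mul z u + z + u = 0] in
  (u, mul z x + x).

(* A subset [X : set A] is used as a type, that of the elements of [A] lying
   in [X]. *)
Definition is_restriction (A : zmodType) (mul : A -> A -> A) (X : set A)
    (r : X * X -> X * X) : Prop :=
  forall x y : X,
    (val (r (x, y)).1, val (r (x, y)).2) = yb_map mul (val x, val y).

Record is_ideal (A : zmodType) (mul : A -> A -> A) (I : set A) : Prop :=
  IsIdeal {
    ideal0 : I 0;
    idealB : forall x y, I x -> I y -> I (x - y);
    ideal_mull : forall z x, I x -> I (mul z x);
    ideal_mulr : forall x z, I x -> I (mul x z) }.

Section Quotient.
Variables (A : zmodType) (X I : set A).

(* [x]_I, a subset of A that need not be contained in X *)
Definition coset (x : A) : set A := [set x + i | i in I].

Definition cosets : set (set A) := [set coset x | x in X].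

Definition mk_coset (x : X) : cosets :=
  SigSub (mem_set (imageP coset (set_valP x))).

Definition coset_sim (C D : cosets) : Prop :=
  exists x y : X, [/\ C = mk_coset x, D = mk_coset y & I (val x - val y)].

(* X_I, the set of equivalence classes, which are sets of cosets *)
Definition XI : set (set cosets) := range (fun C => [set D | coset_sim C D]).

Definition mk_XI (x : X) : XI :=
  SigSub (mem_set (imageT (fun C => [set D | coset_sim C D]) (mk_coset x))).

Definition is_quotient_map (r : X * X -> X * X) (rt : XI * XI -> XI * XI) :
    Prop :=
  forall x y : X,
    rt (mk_XI x, mk_XI y) = (mk_XI (lact r x y), mk_XI (ract r x y)).

End Quotient.

Arguments XI {A} X I _.

(* Main.v *)
Require Import Defs.
From mathcomp Require Import all_boot all_order all_algebra.
From mathcomp Require Import boolp classical_sets functions.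
From Corelib Require Import RelationClasses.

(** In a left brace put [lam a b = a . b + b], so that the circle operation
    reads [circ a b = a + lam a b].  Since [circ] is associative, [lam] is an
    action of the circle group on [(A, +)] by automorphisms, and the
    Yang-Baxter map sends [(x, y)] to [(u, v)] with [u = lam x y] and
    [lam u v = x].  Equivalently [x + u = circ x y = circ u v], and this
    symmetry between the two pairs makes the map involutive.

    An ideal [I] is stable under every [lam a], and [lam j c] is congruent to
    [c] modulo [I] for [j] in [I].  As [a + i = circ a j] with
    [j = lam (cinv a) i] in [I], the element [lam (a + i) c] is congruent to
    [lam a c]: so [lam] is compatible with congruence modulo [I] in both
    arguments ([lam_congr]).  Because [lam a] is invertible one can also cancel
    ([lam_congr_cancel]), and every element defined by an equation
    [lam a b = c] then has a class that depends only on those of [a] and [c].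
    This covers the second component of the Yang-Baxter map and the circle
    inverse.

    Hence [r] descends to [X_I], along the surjection [mk_XI] whose fibres are
    the congruence classes.  The braid equation and involutivity are
    identities, so they pass to the image of a surjection, and involutivity
    gives bijectivity.  For non-degeneracy, surjectivity passes to the quotient
    likewise; injectivity is a cancellation property modulo [I], given for the
    first component by [lam_congr_cancel], and for the second by the formula
    [cinv v = lam (cinv y) (cinv x)] ([cinv_rho]). *)

Set Implicit Arguments.
Unset Strict Implicit.
Unset Printing Implicit Defensive.

Import GRing.Theory.
Local Open Scope classical_set_scope.
Local Open Scope ring_scope.

(** * The circle group of a left brace and its action *)

Section Brace.
Variables (A : zmodType) (mul : A -> A -> A).
Hypothesis brace : is_left_brace mul.

Local Notation circ := (brace_circ mul).

Definition lam (a b : A) : A := mul a b + b.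

(** The inverse for the circle operation, given by the same choice as in
    [yb_map] so that [yb_mapE] holds by computation. *)
Definition cinv (a : A) : A := xget 0 [set z : A | mul z a + z + a = 0].

Definition rho (x y : A) : A := lam (cinv (lam x y)) x.

Lemma yb_mapE x y : yb_map mul (x, y) = (lam x y, rho x y).
Proof. by []. Qed.

Lemma circE a b : circ a b = a + lam a b.
Proof. by rewrite /brace_circ /lam addrA (addrC a). Qed.

Lemma lamD a b c : lam a (b + c) = lam a b + lam a c.
Proof. by rewrite /lam (left_brace_distr brace) addrACA. Qed.

Lemma lam0 a : lam a 0 = 0.
Proof. by apply: (addrI (lam a 0)); rewrite -lamD !addr0. Qed.

Lemma lamN a b : lam a (- b) = - lam a b.
Proof. by apply: (addrI (lam a b)); rewrite -lamD !subrr lam0. Qed.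

Lemma lamB a b c : lam a (b - c) = lam a b - lam a c.
Proof. by rewrite lamD lamN. Qed.

Lemma circA : associative circ.
Proof. by have [] := left_brace_group brace. Qed.

(** Left distributivity makes [0] a right identity for [circ], so it is the
    identity of the circle group. *)
Lemma circ_group0 :
  left_id 0 circ /\ forall a, exists b, circ a b = 0 /\ circ b a = 0.
Proof.
have [_ [e [e1 _ eV]]] := left_brace_group brace.
suff -> : 0 = e by [].
by rewrite -[LHS]e1 circE lam0 addr0.
Qed.

Lemma lam0x b : lam 0 b = b.
Proof. by rewrite -[LHS]add0r -circE (proj1 circ_group0). Qed.

Lemma lam_circ a b c : lam (circ a b) c = lam a (lam b c).
Proof.
apply: (addrI (circ a b)); rewrite -circE -circA circE (circE b) lamD addrA.
by rewrite -circE.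
Qed.

Lemma circVx a : circ (cinv a) a = 0.
Proof.
have [b [_ ba]] := proj2 circ_group0 a.
exact: (@xgetI _ 0 [set z | mul z a + z + a = 0] b ba).
Qed.

Lemma circxV a : circ a (cinv a) = 0.
Proof.
have [b [ab _]] := proj2 circ_group0 a.
suff -> : cinv a = b by [].
have -> : cinv a = circ (cinv a) 0 by rewrite circE lam0 addr0.
by rewrite -ab circA circVx (proj1 circ_group0).
Qed.

Lemma lamK a : cancel (lam a) (lam (cinv a)).
Proof. by move=> b; rewrite -lam_circ circVx lam0x. Qed.

Lemma lamVK a : cancel (lam (cinv a)) (lam a).
Proof. by move=> b; rewrite -lam_circ circxV lam0x. Qed.

Lemma lam_inj a : injective (lam a).
Proof. exact: can_inj (lamK a). Qed.

(** This equation characterizes the circle inverse through [lam]. *)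
Lemma lam_cinv a : lam a (cinv a) = - a.
Proof. by apply: (addrI a); rewrite -circE circxV subrr. Qed.

Lemma cinvK : involutive cinv.
Proof.
move=> a; apply: (@lam_inj (cinv a)); rewrite lam_cinv.
by apply: (addrI (cinv a)); rewrite -circE circVx subrr.
Qed.

(** * The Yang-Baxter map of a left brace *)

Lemma lam_rho x y : lam (lam x y) (rho x y) = x.
Proof. exact: lamVK. Qed.

Lemma yb_mapK : involutive (yb_map mul).
Proof.
move=> [x y]; rewrite yb_mapE yb_mapE lam_rho; congr (_, _).
by rewrite /rho lam_rho lamK.
Qed.

(** The map [rho _ y] is conjugate, by the circle inverse, to the bijection
    [lam (cinv y)].  With [u = lam x y] and [v = rho x y], the equality
    [circ u v = circ x y] says that [lam u (lam v c) = lam x (lam y c)] for all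
    [c]; both [c = cinv v] and [c = lam (cinv y) (cinv x)] are sent to [- x] by
    this injective map. *)
Lemma cinv_rho x y : cinv (rho x y) = lam (cinv y) (cinv x).
Proof.
have ru : circ (lam x y) (rho x y) = circ x y.
  by rewrite circE lam_rho addrC -circE.
set v := rho x y in ru *.
have lamv c : lam (lam x y) (lam v c) = lam x (lam y c).
  by rewrite -!lam_circ ru.
apply: (@lam_inj v); rewrite lam_cinv; apply: (@lam_inj (lam x y)).
by rewrite lamv lamVK lam_cinv lamN lam_rho.
Qed.

(** * Congruence modulo an ideal *)

Variable I : set A.
Hypothesis idealI : is_ideal mul I.

Lemma idealN x : I x -> I (- x).
Proof.
move=> Ix; rewrite -sub0r; apply: (idealB idealI) => //.
exact: (ideal0 idealI).
Qed.

Lemma idealD x y : I x -> I y -> I (x + y).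
Proof.
move=> Ix Iy; rewrite -(opprK y); apply: (idealB idealI) => //.
exact: idealN.
Qed.

Lemma ideal_lam a x : I x -> I (lam a x).
Proof. by move=> Ix; apply: idealD => //; apply: (ideal_mull idealI). Qed.

Lemma congr_refl x : I (x - x).
Proof. by rewrite subrr; apply: (ideal0 idealI). Qed.

Lemma congr_sym x y : I (x - y) -> I (y - x).
Proof. by move=> /idealN; rewrite opprB. Qed.

Lemma congr_trans x y z : I (x - y) -> I (y - z) -> I (x - z).
Proof. by move=> xy yz; rewrite -(subrKA y); apply: idealD. Qed.

(** Multiplication is additive on the right only, so a change of the left
    argument by an element of [I] is turned into a circle product: [a] is
    [circ a' j] for [j = lam (cinv a') (a - a')], which lies in [I]. *)
Lemma lam_congr a a' b b' :
  I (a - a') -> I (b - b') -> I (lam a b - lam a' b').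
Proof.
move=> Ia Ib; apply: (@congr_trans _ (lam a b')).
  by rewrite -lamB; apply: ideal_lam.
pose j := lam (cinv a') (a - a').
have -> : a = circ a' j by rewrite circE lamVK addrC subrK.
rewrite lam_circ -lamB; apply: ideal_lam.
by rewrite /lam addrK; apply: (ideal_mulr idealI); apply: ideal_lam.
Qed.

Lemma lam_congr_cancel a a' b b' :
  I (a - a') -> I (lam a b - lam a' b') -> I (b - b').
Proof.
move=> Ia Il; rewrite -(lamK a (b - b')); apply: ideal_lam; rewrite lamB.
by apply: congr_trans Il _; apply: lam_congr (congr_sym Ia) (congr_refl _).
Qed.

Lemma cinv_congr a a' : I (a - a') -> I (cinv a - cinv a').
Proof.
move=> Ia; apply: (lam_congr_cancel Ia); rewrite !lam_cinv -opprD.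
exact: idealN.
Qed.

Lemma rho_congr x x' y y' :
  I (x - x') -> I (y - y') -> I (rho x y - rho x' y').
Proof.
move=> Ix Iy; apply: (lam_congr_cancel (lam_congr Ix Iy)).
by rewrite !lam_rho.
Qed.

Lemma rho_congr_cancel x x' y y' :
  I (y - y') -> I (rho x y - rho x' y') -> I (x - x').
Proof.
move=> /cinv_congr Iy /cinv_congr; rewrite !cinv_rho.
by move=> /(lam_congr_cancel Iy)/cinv_congr; rewrite !cinvK.
Qed.

End Brace.

(** * Descent of solutions along a surjection *)

Section Descent.
Variables (T Q : Type) (p : T -> Q).
Hypothesis p_surj : forall q, exists x, q = p x.

Lemma surj_inj_bijective (U V : Type) (f : U -> V) :
  (forall v, exists u, v = f u) -> injective f -> bijective f.
Proof.
move=> /choice[g gP] f_inj; exists g => [u|v]; last by rewrite -gP.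
by apply: f_inj; rewrite -gP.
Qed.

(** A self-map of [T * T] preserving the fibres of [p * p] induces a map on
    [Q * Q], computed on arbitrary representatives. *)
Lemma descent_exists_unique (r : T * T -> T * T) :
  (forall x x' y y', p x = p x' -> p y = p y' ->
     p (lact r x y) = p (lact r x' y') /\ p (ract r x y) = p (ract r x' y')) ->
  exists! rt : Q * Q -> Q * Q,
    forall x y, rt (p x, p y) = (p (lact r x y), p (ract r x y)).
Proof.
move=> r_congr; have [s sP] := choice p_surj.
exists (fun q => (p (lact r (s q.1) (s q.2)), p (ract r (s q.1) (s q.2)))).
split=> [x y|rt rtE] /=.
  by have [-> ->] := r_congr _ _ _ _ (esym (sP (p x))) (esym (sP (p y))).
by apply/funext => -[a b] /=; rewrite -rtE -!sP.
Qed.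

Variables (r : T * T -> T * T) (rt : Q * Q -> Q * Q).
Hypothesis rtE :
  forall x y, rt (p x, p y) = (p (lact r x y), p (ract r x y)).

Lemma lact_descent x y : lact rt (p x) (p y) = p (lact r x y).
Proof. by rewrite /lact rtE. Qed.

Lemma ract_descent x y : ract rt (p x) (p y) = p (ract r x y).
Proof. by rewrite /ract rtE. Qed.

Lemma involutive_descent : involutive r -> involutive rt.
Proof.
move=> rK [a b]; have [x ->] := p_surj a; have [y ->] := p_surj b.
by rewrite rtE rtE /lact /ract -surjective_pairing rK.
Qed.

Lemma ybe_solution_descent :
  involutive r -> ybe_solution r -> ybe_solution rt.
Proof.
move=> rK [[x0] _ braid]; split; first exact: (inhabits (p x0)).
  exact: inv_bij (involutive_descent rK).
pose p3 (t : T * T * T) := (p t.1.1, p t.1.2, p t.2).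
have r1E t : ybe_r1 rt (p3 t) = p3 (ybe_r1 r t).
  by case: t => [[x y] z]; rewrite /ybe_r1 /p3 /= rtE.
have r2E t : ybe_r2 rt (p3 t) = p3 (ybe_r2 r t).
  by case: t => [[x y] z]; rewrite /ybe_r2 /p3 /= lact_descent ract_descent.
move=> [[a b] c].
have [x ->] := p_surj a; have [y ->] := p_surj b; have [z ->] := p_surj c.
rewrite -[(p x, p y, p z)]/(p3 (x, y, z)).
by rewrite !(r1E, r2E) braid.
Qed.

(** Injectivity does not pass to quotients, hence the two cancellation
    hypotheses. *)
Lemma nondegenerate_descent :
  (forall x y y', p (lact r x y) = p (lact r x y') -> p y = p y') ->
  (forall y x x', p (ract r x y) = p (ract r x' y) -> p x = p x') ->
  ybe_nondegenerate r -> ybe_nondegenerate rt.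
Proof.
move=> lI rI [lB rB]; split=> q; have [x ->] := p_surj q.
- apply: surj_inj_bijective => [b|b b'].
    have [y ->] := p_surj b; have [g _ gK] := lB x.
    by exists (p (g y)); rewrite lact_descent gK.
  have [y ->] := p_surj b; have [y' ->] := p_surj b'.
  by rewrite !lact_descent; apply: lI.
- apply: surj_inj_bijective => [b|b b'].
    have [y ->] := p_surj b; have [g _ gK] := rB x.
    by exists (p (g y)); rewrite ract_descent gK.
  have [y ->] := p_surj b; have [y' ->] := p_surj b'.
  by rewrite !ract_descent; apply: rI.
Qed.

End Descent.

(** * The classes modulo an ideal *)

Section Classes.
Variables (A : zmodType) (mul : A -> A -> A) (X I : set A).
Hypothesis idealI : is_ideal mul I.

Lemma mk_coset_surj (C : cosets X I) : exists x : X, C = mk_coset I x.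
Proof.
case: C => C CX; have [x Xx xC] := set_mem CX.
by exists (SigSub (mem_set Xx)); apply: val_inj.
Qed.

Lemma mk_coset_congr (x y : X) :
  mk_coset I x = mk_coset I y -> I (val x - val y).
Proof.
move=> /(congr1 val) /= xy.
have : coset I (val x) (val x).
  by exists 0; rewrite ?addr0 //; apply: (ideal0 idealI).
by rewrite xy => -[i Ii <-]; rewrite addrC addKr.
Qed.

(** The representatives in the definition of [coset_sim] are existentially
    quantified, hence the transitivity argument. *)
Lemma coset_simE (x y : X) :
  coset_sim (mk_coset I x) (mk_coset I y) <-> I (val x - val y).
Proof.
split=> [[x' [y' [/mk_coset_congr xx' /mk_coset_congr yy' xy']]]|xy].
  apply: (congr_trans idealI xx'); apply: (congr_trans idealI xy').
  exact: congr_sym idealI _ _ yy'.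
by exists x, y.
Qed.

Lemma coset_sim_equivalence : Equivalence (@coset_sim A X I).
Proof.
split=> [C|C D|C D E].
- by have [x ->] := mk_coset_surj C; apply/coset_simE/(congr_refl idealI).
- have [x ->] := mk_coset_surj C; have [y ->] := mk_coset_surj D.
  by move=> /coset_simE xy; apply/coset_simE/(congr_sym idealI).
- have [x ->] := mk_coset_surj C; have [y ->] := mk_coset_surj D.
  have [z ->] := mk_coset_surj E.
  move=> /coset_simE xy /coset_simE yz; apply/coset_simE.
  exact: (congr_trans idealI xy yz).
Qed.

Lemma mk_XI_surj (q : XI X I) : exists x : X, q = mk_XI I x.
Proof.
case: q => q qX; have [C _ Cq] := set_mem qX.
have [x Cx] := mk_coset_surj C.
by exists x; apply: val_inj; rewrite /= -Cq Cx.
Qed.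

Lemma mk_XI_eq (x y : X) : mk_XI I x = mk_XI I y <-> I (val x - val y).
Proof.
have [_ simC simT] := coset_sim_equivalence.
split=> [/(congr1 val) /= xy|/coset_simE xy].
  suff : [set D | coset_sim (mk_coset I x) D] (mk_coset I y).
    by move=> /coset_simE.
  by rewrite xy /=; apply/coset_simE/(congr_refl idealI).
apply: val_inj; apply/seteqP; split=> D /= h.
  by apply: simT h; apply: simC.
exact: simT xy h.
Qed.

End Classes.

Theorem proposition22 (A : zmodType) (mul : A -> A -> A)
    (X : set A) (r : X * X -> X * X) (I : set A) :
  is_left_brace mul ->
  ybe_solution r ->
  is_restriction mul r ->
  is_ideal mul I ->
  [/\ forall x y : X,
        coset_sim (mk_coset I x) (mk_coset I y) <-> I (val x - val y),
      Equivalence (@coset_sim A X I),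
      exists! rt : XI X I * XI X I -> XI X I * XI X I, is_quotient_map r rt &
      forall rt : XI X I * XI X I -> XI X I * XI X I, is_quotient_map r rt ->
        [/\ ybe_solution rt, involutive rt &
            ybe_nondegenerate r -> ybe_nondegenerate rt]].
Proof.
move=> brace sol restr idealI.
have lactE x y : val (lact r x y) = lam mul (val x) (val y).
  by have /(congr1 fst) := restr x y.
have ractE x y : val (ract r x y) = rho mul (val x) (val y).
  by have /(congr1 snd) := restr x y.
have rK : involutive r.
  move=> [x y]; rewrite [r (x, y)]surjective_pairing.
  have := yb_mapK brace (val x, val y).
  rewrite -restr -restr => -[e1 e2].
  by rewrite [LHS]surjective_pairing; congr (_, _); apply: val_inj.
have surj := @mk_XI_surj A X I.
have eqE := mk_XI_eq idealI.
split.
- exact: coset_simE idealI.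
- exact: coset_sim_equivalence idealI.
- apply: (descent_exists_unique surj) => x x' y y' /eqE xx' /eqE yy'.
  split; apply/eqE; rewrite ?lactE ?ractE.
    exact: lam_congr.
  exact: rho_congr.
- move=> rt rtE; split.
  + exact: (ybe_solution_descent surj rtE rK sol).
  + exact: (involutive_descent surj rtE rK).
  + apply: (nondegenerate_descent surj rtE) => [x y y'|y x x'] /eqE h.
      apply/eqE; rewrite !lactE in h.
      exact: lam_congr_cancel brace _ idealI _ _ _ _ (congr_refl idealI _) h.
    apply/eqE; rewrite !ractE in h.
    exact: rho_congr_cancel brace _ idealI _ _ _ _ (congr_refl idealI _) h.
Qed.
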